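(* Let $\Sigma$ be a finite alphabet and let $\mathcal{L}=(L_i)_{i\in\mathbb{N}}$ be a family of languages over $\Sigma$, where each $L_i$ is given by an underlying representation of size $\mathrm{size}(i)\in\mathbb{N}$. If $\mathcal{L}$ possesses a family of polynomial-size positive characteristic sets, then $\mathcal{L}$ possesses a family of polynomial-size telltales.
   Context: A language over $\Sigma$ is a subset of $\Sigma^*$. A set $S\subseteq\Sigma^*\times\{0,1\}$ is consistent with a language $L$ iff $(s,1)\in S$ implies $s\in L$ and $(s,0)\in S$ implies $s\notin L$. A family $(C_i)_{i\in\mathbb{N}}$ of finite subsets of $\Sigma^*\times\{1\}$ is a family of positive characteristic sets for $\mathcal{L}$ iff: (1) $C_i$ is consistent with $L_i$ for all $i$; (2) for all $i,j$, if $L_i\ne L_j$ and $C_i$ is consistent with $L_j$, then $C_j$ is not consistent with $L_i$. A family $(T_i)_{i\in\mathbb{N}}$ of finite subsets of $\Sigma^*$ is a family of telltales for $\mathcal{L}$ iff: (1) $T_i\subseteq L_i$ for all $i$; (2) for all $i,j$, if $L_i\ne L_j$ and $T_i\subseteq L_j$, then $L_j\not\subset L_i$ (where $\subset$ denotes proper inclusion). Such a family $(C_i)$ (resp. $(T_i)$) is polynomial-size if there is a polynomial $q$ such that for all $i$ the size (cardinality) of $C_i$ (resp. $T_i$) is at most $q(\mathrm{size}(i))$. *)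

(* Defs.v *)
From mathcomp Require Import all_boot all_order all_algebra finmap.
From mathcomp Require Import boolp classical_sets.

Set Implicit Arguments.
Unset Strict Implicit.
Unset Printing Implicit Defensive.

Local Open Scope classical_set_scope.

Definition language (Sigma : finType) := set (seq Sigma).

(* Labels in {0,1} are booleans: [(s, true)] is a positive example and
   [(s, false)] a negative one. *)
Definition consistent (Sigma : finType) (S : set (seq Sigma * bool))
    (L : language Sigma) : Prop :=
  forall s : seq Sigma,
    (S (s, true) -> L s) /\ (S (s, false) -> ~ L s).

Definition positive_characteristic_sets (Sigma : finType)
    (L : nat -> language Sigma) (C : nat -> {fset seq Sigma * bool}) : Prop :=
  [/\ forall i, [set` C i] `<=` [set x | x.2 = true],
      forall i, consistent [set` C i] (L i)
    & forall i j, L i <> L j ->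
        consistent [set` C i] (L j) -> ~ consistent [set` C j] (L i)].

(* [`<`] on sets is proper inclusion. *)
Definition telltales (Sigma : finType)
    (L : nat -> language Sigma) (T : nat -> {fset seq Sigma}) : Prop :=
  (forall i, [set` T i] `<=` L i) /\
  (forall i j, L i <> L j -> [set` T i] `<=` L j -> ~ (L j `<` L i)).

(* [rsize i] is the size of the representation of the [i]-th language.  A
   bound with natural, rational or real coefficients yields one with integer
   coefficients, so [{poly int}] loses no generality. *)
Definition polynomial_size (K : choiceType) (rsize : nat -> nat)
    (F : nat -> {fset K}) : Prop :=
  exists q : {poly int},
    forall i, (#|` F i|%:Z <= q.[(rsize i)%:Z])%R.

(* Main.v *)
(* Dropping the labels of the positive characteristic sets yields telltales:
   if [C_i] is consistent with [L_j] and [L_j] is included in [L_i], then [C_j],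
   being positive and consistent with [L_j], is consistent with [L_i]. *)
Require Import Defs.
From mathcomp Require Import all_boot all_order all_algebra finmap.
From mathcomp Require Import boolp classical_sets.

Local Open Scope classical_set_scope.

(** A pair labelled [false] cannot occur in [S], so the negative clause of [consistent] is vacuous.
    Consistency thus becomes an inclusion, the form used for telltales, and passes to larger
    languages. *)
Lemma consistent_positiveP (Sigma : finType) (S : set (seq Sigma * bool))
    (L : language Sigma) :
  S `<=` [set x | x.2 = true] -> consistent S L <-> fst @` S `<=` L.
Proof.
move=> Spos; split=> [SL _ [[s b] Ss <-]|SL s].
  by move: (Spos _ Ss) => /= bE; rewrite bE in Ss; exact: (SL s).1.
by split=> [Ss|/Spos //]; apply: SL; exists (s, true).
Qed.

Local Close Scope classical_set_scope.

Theorem corollary1 (Sigma : finType) (L : nat -> language Sigma)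
    (rsize : nat -> nat) :
  (exists C : nat -> {fset seq Sigma * bool},
     positive_characteristic_sets L C /\ polynomial_size rsize C) ->
  exists T : nat -> {fset seq Sigma},
    telltales L T /\ polynomial_size rsize T.
Proof.
case=> C [[Cpos Ccons Cchar] [q Cq]].
exists (fun i => [fset x.1 | x in C i]%fset); split; first split.
- by move=> i; rewrite set_imfset; apply/(consistent_positiveP _ _ _ (Cpos i)).
- move=> i j LiLj; rewrite set_imfset.
  move=> /(consistent_positiveP _ _ _ (Cpos i)) CiLj [LjLi _].
  (* It remains to contradict [Cchar]: the words of [C j] lie in [L j], hence in [L i]. *)
  apply: (Cchar i j LiLj CiLj); apply/consistent_positiveP => //.
  by apply: subset_trans LjLi; apply/consistent_positiveP.
(* Taking an image cannot increase cardinality, so the same [q] bounds the telltales. *)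
- exists q => i; apply: Order.POrderTheory.le_trans (Cq i).
  by rewrite ssrint.lez_nat leq_imfset_card.
Qed.
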